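(* Let $d\in\mathbb{N}$, $\alpha\in[0,1)$, $\beta\in(\alpha^2,1)$, $\varepsilon\in(0,\infty)$, let $\Phi_n\colon(\mathbb{R}^d)^n\to\mathbb{R}^d$, $n\in\mathbb{N}$, be the $\alpha$-$\beta$-$\varepsilon$-Adam optimizer, let $\gamma\colon\mathbb{N}\to[0,\infty)$ be bounded, let $J\colon\mathbb{N}\to\mathbb{N}$ be a function, let $\lambda\in\mathbb{R}^d$, $\mathfrak{c}\in[0,\infty)$, let $\ell\colon\mathbb{R}^d\times\mathbb{R}^d\to\mathbb{R}$ satisfy for all $x,\theta\in\mathbb{R}^d$ that $\ell(\theta,x)=\|\operatorname{diag}(\lambda)(\theta-x)\|^2$, let $(\Omega,\mathcal{F},\mathbb{P})$ be a probability space, for every $n,j\in\mathbb{N}$ let $X_{n,j}\colon\Omega\to[-\mathfrak{c},\mathfrak{c}]^d$ be a random variable, and let $\mathcal{G}\colon\mathbb{N}\times\Omega\to\mathbb{R}^d$ and $\Theta\colon\mathbb{N}_0\times\Omega\to\mathbb{R}^d$ satisfy for all $n\in\mathbb{N}$ that $$\mathcal{G}_n=\frac{1}{J_n}\sum_{j=1}^{J_n}(\nabla_\theta\ell)(\Theta_{n-1},X_{n,j})\qquad\text{and}\qquad\Theta_n=\Theta_{n-1}-\gamma_n\Phi_n(\mathcal{G}_1,\mathcal{G}_2,\dots,\mathcal{G}_n).$$ Then there exists $c\in\mathbb{R}$ such that $\sup_{n\in\mathbb{N}_0}\|\Theta_n\|\le c\|\Theta_0\|+c$ (at every $\omega\i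n\Omega$).
   Context: $\mathbb{N}=\{1,2,3,\dots\}$, $\mathbb{N}_0=\mathbb{N}\cup\{0\}$, $\|\cdot\|$ is the Euclidean norm, $0^0=1$, and $\operatorname{diag}(x)y=(x_1y_1,\dots,x_dy_d)$ for $x,y\in\mathbb{R}^d$. The $\alpha$-$\beta$-$\varepsilon$-Adam optimizer is the sequence of functions $\Phi_n=(\Phi_n^{(1)},\dots,\Phi_n^{(d)})\colon(\mathbb{R}^d)^n\to\mathbb{R}^d$, $n\in\mathbb{N}$, given for all $n\in\mathbb{N}$, $i\in\{1,\dots,d\}$, $g_k=(g_k^{(1)},\dots,g_k^{(d)})\in\mathbb{R}^d$, $k\in\{1,\dots,n\}$, by $$\Phi_n^{(i)}(g_1,\dots,g_n)=\frac{\frac{1-\alpha}{1-\alpha^n}\sum_{k=1}^n\alpha^{n-k}g_k^{(i)}}{\varepsilon+\big[\frac{1-\beta}{1-\beta^n}\sum_{k=1}^n\beta^{n-k}|g_k^{(i)}|^2\big]^{1/2}}.$$ *)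

(* Defs.v *)
From HB Require Import structures.
From mathcomp Require Import all_boot all_order all_algebra.
From mathcomp Require Import all_classical all_reals all_analysis.

Set Implicit Arguments.
Unset Strict Implicit.
Unset Printing Implicit Defensive.

Import Order.TTheory GRing.Theory Num.Theory.
Import numFieldNormedType.Exports.

Local Open Scope classical_set_scope.
Local Open Scope ring_scope.

(* The library norm on 'rV[R]_d is the sup norm, not the Euclidean one. *)
Definition enorm (R : realType) (d : nat) (x : 'rV[R]_d) : R :=
  Num.sqrt (\sum_(i < d) x 0 i ^+ 2).

(* diag(x) y *)
Definition diag_act (R : realType) (d : nat) (x y : 'rV[R]_d) : 'rV[R]_d :=
  \row_i (x 0 i * y 0 i).

Definition gradient (R : realType) (d : nat) (f : 'rV[R]_d -> R)
    (a : 'rV[R]_d) : 'rV[R]_d :=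
  \row_i 'D_(delta_mx 0 i) f a.

(* R^d with its Borel sigma-algebra. *)
Notation borel_rV R d := (g_sigma_algebraType (@open 'rV[R]_d)).

(* The index k : 'I_n is shifted by one: the component tnth g k is the
   gradient g_(k+1) of the (k+1)-st step. *)
Definition adam (R : realType) (d : nat) (alpha beta eps : R) (n : nat)
    (g : n.-tuple 'rV[R]_d) : 'rV[R]_d :=
  \row_i
    ((1 - alpha) / (1 - alpha ^+ n)
       * (\sum_(k < n) alpha ^+ (n - k.+1) * tnth g k 0 i)
     / (eps + Num.sqrt ((1 - beta) / (1 - beta ^+ n)
          * (\sum_(k < n) beta ^+ (n - k.+1) * `|tnth g k 0 i| ^+ 2)))).

(* Main.v *)
(* In each coordinate the step is theta_n = theta_(n-1) - s_n m_n, where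
   m_n = alpha m_(n-1) + g_n is the momentum and 0 <= s_n <= sup gamma / eps.
   Since alpha^2 < beta, Cauchy-Schwarz bounds m_n by the square root in the
   denominator, so all increments are bounded by a constant D. Hence, whenever
   theta_n lies above the data range b, the recent past of theta is bounded
   below and m_n >= -A for a constant A. While theta stays above b the new
   gradients are nonnegative, so the negative part of the momentum decays
   geometrically and can push theta up by at most a constant in total; thus
   theta_n <= max(theta_0, const), and symmetrically from below. *)
Require Import Defs.
From HB Require Import structures.
From mathcomp Require Import all_boot all_order all_algebra.
From mathcomp Require Import all_classical all_reals all_analysis.
From mathcomp Require Import ring lra.

Set Implicit Arguments.
Unset Strict Implicit.
Unset Printing Implicit Defensive.

Import Order.TTheory GRing.Theory Num.Theory.
Import numFieldNormedType.Exports.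

Local Open Scope classical_set_scope.
Local Open Scope ring_scope.

(** * Momentum recursion in one coordinate *)

(** One step from below [b] lands at most at [b + D]. The last summand is [q * A], the total upward
    push left in the momentum after that crossing. *)
Lemma momentum_ub (R : realFieldType) (alpha kappa a D b : R)
    (theta m g s : nat -> R) :
    0 <= alpha < 1 -> 0 <= kappa -> 0 <= a ->
    m 0%N = 0 -> (forall n, m n.+1 = alpha * m n + g n.+1) ->
    (forall n, theta n.+1 = theta n - s n.+1 * m n.+1) ->
    (forall n, 0 <= s n.+1 <= a) ->
    (forall n, `|theta n.+1 - theta n| <= D) ->
    (forall n, kappa * (theta n - b) <= g n.+1) ->
  forall n, theta n <= Num.max (theta 0%N)
    (b + D + a * alpha / (1 - alpha) * (kappa * D / (1 - alpha) ^+ 2)).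
Proof.
move=> /andP[al0 al1] ka0 a0 m0 mS thS sP dth gP.
have al1' : 0 < 1 - alpha by rewrite subr_gt0.
set p := kappa / (1 - alpha); set q := a * alpha / (1 - alpha).
have -> : kappa * D / (1 - alpha) ^+ 2 = p * D / (1 - alpha).
  by rewrite /p; field; rewrite gt_eqF.
set A := p * D / (1 - alpha); set M := Num.max _ _.
have D0 : 0 <= D := le_trans (normr_ge0 _) (dth 0%N).
have p0 : 0 <= p by rewrite divr_ge0 // ltW.
have q0 : 0 <= q by rewrite divr_ge0 ?mulr_ge0 // ltW.
have A0 : 0 <= A by apply: divr_ge0 (ltW al1'); apply: mulr_ge0.
have pE : alpha * p + kappa = p by rewrite /p; field; rewrite gt_eqF.
have qE : alpha * (a + q) = q by rewrite /q; field; rewrite gt_eqF.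
have AE : alpha * A + p * D = A by rewrite /A; field; rewrite gt_eqF.
have dth' n : theta n <= theta n.+1 + D /\ theta n.+1 <= theta n + D.
  have := dth n; rewrite ler_norml => /andP[? ?]. split; lra.
(* The constants p and A are the fixed points of [p = alpha * p + kappa] and
   [A = alpha * A + p * D] that close this induction. *)
have m_lb n : - A - p * Num.max (b - theta n) 0 <= m n.
  elim: n => [|n IH].
    have : 0 <= p * Num.max (b - theta 0%N) 0.
      by rewrite mulr_ge0 // le_max lexx orbT.
    by rewrite m0; lra.
  set e := Num.max _ _ in IH; set e' := Num.max _ _.
  have e_e' : e <= e' + D.
    have : b - theta n.+1 <= e' by rewrite le_max lexx.
    have : 0 <= e' by rewrite le_max lexx orbT.
    by case: (dth' n) => ? ? ? ?; rewrite ge_max; apply/andP; split; lra.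
  have be : b - theta n <= e by rewrite le_max lexx.
  have h1 : kappa * - e <= g n.+1.
    by apply: le_trans (gP n); apply: ler_wpM2l => //; lra.
  have h2 : alpha * (- A - p * e) <= alpha * m n by apply: ler_wpM2l.
  have h3 : p * e <= p * (e' + D) by apply: ler_wpM2l.
  have pEe : alpha * p * e + kappa * e = p * e by rewrite -mulrDl pE.
  by rewrite mS; lra.
(* The Lyapunov function [theta + q * m^-] does not increase above level [b];
   [q] solves [q = alpha * (a + q)]. *)
have V_ub n : theta n < b \/ theta n + q * Num.max (- m n) 0 <= M.
  elim: n => [|n IH].
    by right; rewrite m0 oppr0 maxxx mulr0 addr0 le_max lexx.
  have [lt_b|ge_b] := ltP (theta n.+1) b; first by left.
  right.
  have mA : Num.max (- m n.+1) 0 <= A.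
    have := m_lb n.+1; rewrite (max_idPr _) ?subr_le0 // mulr0 => ?.
    by rewrite ge_max A0 andbT; lra.
  (* Upward crossing of level [b]: the bound starts afresh from [b + D] and [mA]. *)
  have [lt_b|ge_bn] := ltP (theta n) b.
    rewrite le_max; apply/orP; right.
    by apply: lerD; [case: (dth' n); lra | apply: ler_wpM2l].
  case: IH => [|IH]; first by lra.
  apply: le_trans IH.
  have e0 : 0 <= Num.max (- m n) 0 by rewrite le_max lexx orbT.
  have f0 : 0 <= Num.max (- m n.+1) 0 by rewrite le_max lexx orbT.
  have ne : - m n <= Num.max (- m n) 0 by rewrite le_max lexx.
  have nf : - m n.+1 <= Num.max (- m n.+1) 0 by rewrite le_max lexx.
  (* Above [b] the new gradient is nonnegative, so the negative part of the momentum contracts by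
     [alpha]. *)
  have fe : Num.max (- m n.+1) 0 <= alpha * Num.max (- m n) 0.
    rewrite ge_max mulr_ge0 // andbT mS.
    have h1 : 0 <= g n.+1.
      by apply: le_trans (gP n); rewrite mulr_ge0 // subr_ge0.
    have := ler_wpM2l al0 ne; lra.
  move: e0 f0 nf fe; set e := Num.max (- m n) 0; set f := Num.max _ _.
  move=> e0 f0 nf fe.
  have /andP[s0 sa] := sP n.
  have h1 : s n.+1 * - m n.+1 <= a * f.
    by apply: le_trans (ler_wpM2l s0 nf) _; apply: ler_wpM2r.
  have h2 : (a + q) * f <= q * e.
    rewrite -[in leRHS]qE (mulrC alpha) -mulrA; apply: ler_wpM2l => //.
    exact: addr_ge0.
  by rewrite thS; lra.
move=> n; case: (V_ub n) => [lt_b|].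
  rewrite le_max; apply/orP; right.
  by have := mulr_ge0 q0 A0; lra.
apply: le_trans; rewrite lerDl mulr_ge0 //.
by rewrite le_max lexx orbT.
Qed.

(** The recursion is invariant under negating [theta], [m] and [g], and this swaps the two gradient
    bounds; so [momentum_ub] applies to both signs. *)
Lemma momentum_bounded (R : realFieldType) (alpha kappa a D b : R)
    (theta m g s : nat -> R) :
    0 <= alpha < 1 -> 0 <= kappa -> 0 <= a -> 0 <= b ->
    m 0%N = 0 -> (forall n, m n.+1 = alpha * m n + g n.+1) ->
    (forall n, theta n.+1 = theta n - s n.+1 * m n.+1) ->
    (forall n, 0 <= s n.+1 <= a) ->
    (forall n, `|theta n.+1 - theta n| <= D) ->
    (forall n, kappa * (theta n - b) <= g n.+1 <= kappa * (theta n + b)) ->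
  forall n, `|theta n| <= `|theta 0%N| +
    (b + D + a * alpha / (1 - alpha) * (kappa * D / (1 - alpha) ^+ 2)).
Proof.
move=> al ka0 a0 b0 m0 mS thS sP dth gP n.
have D0 : 0 <= D := le_trans (normr_ge0 _) (dth 0%N).
have al1' : 0 <= 1 - alpha by case/andP: al => _ /ltW; rewrite subr_ge0.
set C := b + D + _.
have C0 : 0 <= C.
  case/andP: al => al0 _.
  have pw : 0 <= (1 - alpha) ^+ 2 by exact: exprn_ge0.
  apply: addr_ge0; first exact: addr_ge0.
  apply: mulr_ge0.
    by apply: divr_ge0 => //; apply: mulr_ge0.
  by apply: divr_ge0 => //; apply: mulr_ge0.
have maxP x : x <= `|theta 0%N| -> Num.max x C <= `|theta 0%N| + C.
  by move=> xt; have := normr_ge0 (theta 0%N); rewrite ge_max;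
     move=> ?; apply/andP; split; lra.
have up : theta n <= Num.max (theta 0%N) C.
  apply: momentum_ub al ka0 a0 m0 mS thS sP dth _ n => k.
  by case/andP: (gP k).
have lo : - theta n <= Num.max (- theta 0%N) C.
  apply: (@momentum_ub _ alpha kappa a D b (fun k => - theta k)
    (fun k => - m k) (fun k => - g k) s) => //= [|k|k|k|k].
  - by rewrite m0 oppr0.
  - by rewrite mS opprD mulrN.
  - by rewrite thS; ring.
  - by rewrite -opprD normrN.
  - by case/andP: (gP k); lra.
rewrite ler_norml; apply/andP; split.
  by rewrite lerNl (le_trans lo) // maxP // -normrN ler_norm.
by rewrite (le_trans up) // maxP // ler_norm.
Qed.

(** * Exponential moving averages *)

(** The normalizing factor is left out so that the plain momentum recursion [emaS] holds. *)
Definition ema (R : pzRingType) (a : R) (g : nat -> R) (n : nat) : R :=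
  \sum_(k < n) a ^+ (n - k.+1) * g k.+1.

Lemma ema0 (R : pzRingType) (a : R) (g : nat -> R) : ema a g 0 = 0.
Proof. by rewrite /ema big_ord0. Qed.

Lemma emaS (R : pzRingType) (a : R) (g : nat -> R) n :
  ema a g n.+1 = a * ema a g n + g n.+1.
Proof.
rewrite /ema big_ord_recr /= subnn expr0 mul1r mulr_sumr; congr (_ + _).
by apply: eq_bigr => k _; rewrite mulrA -exprS subSS -subSn // subSS.
Qed.

(* The constant is the sum of the geometric series of ratio [alpha ^+ 2 / beta]. *)
Lemma ema_sqr_le (R : realFieldType) (alpha beta : R) (g : nat -> R) n :
    alpha ^+ 2 < beta ->
  ema alpha g n ^+ 2
    <= beta / (beta - alpha ^+ 2) * ema beta (fun k => `|g k| ^+ 2) n.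
Proof.
move=> ab; have d0 : 0 < beta - alpha ^+ 2 by rewrite subr_gt0.
have be0 : 0 <= beta by rewrite (le_trans (sqr_ge0 alpha)) // ltW.
elim: n => [|n IH]; first by rewrite !ema0 expr0n mulr0.
rewrite !emaS real_normK ?num_real //.
move: IH; set m := ema _ _ _; set v := ema _ _ _; set x := g _ => IH.
have := ler_wpM2l be0 IH; set K := beta / _ => h.
(* Completing the square: this term is exactly the gap in the induction step. *)
have sq : 0 <= ((beta - alpha ^+ 2) * m - alpha * x) ^+ 2
               / (beta - alpha ^+ 2) by rewrite divr_ge0 ?sqr_ge0 // ltW.
suff : (alpha * m + x) ^+ 2 + ((beta - alpha ^+ 2) * m - alpha * x) ^+ 2
               / (beta - alpha ^+ 2) = beta * m ^+ 2 + K * x ^+ 2 by lra.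
by rewrite /K; field; rewrite gt_eqF.
Qed.

(** * Step size and increments of Adam *)

(** The factor by which Adam multiplies the momentum [ema alpha g n]; times [gamma n] it is the step
    size [s n] of the recursion. *)
Definition adam_gain (R : rcfType) (alpha beta eps : R) (g : nat -> R) n : R :=
  (1 - alpha) / (1 - alpha ^+ n)
    / (eps + Num.sqrt ((1 - beta) / (1 - beta ^+ n)
                       * ema beta (fun k => `|g k| ^+ 2) n)).

Lemma adamE (R : realType) d (alpha beta eps : R) (G : nat -> 'rV[R]_d) n i :
  adam alpha beta eps [tuple G k.+1 | k < n] 0 i
    = adam_gain alpha beta eps (fun k => G k 0 i) n
      * ema alpha (fun k => G k 0 i) n.
Proof.
rewrite /adam mxE /adam_gain /ema.
rewrite (eq_bigr (fun k : 'I_n => alpha ^+ (n - k.+1) * G k.+1 0 i)); last first.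
  by move=> k _; rewrite tnth_mktuple.
rewrite [in Num.sqrt _](eq_bigr
  (fun k : 'I_n => beta ^+ (n - k.+1) * `|G k.+1 0 i| ^+ 2)); last first.
  by move=> k _; rewrite tnth_mktuple.
by rewrite mulrAC.
Qed.

(** Since [0 <= a ^+ n.+1 <= a], the denominator lies between [1 - a] and 1. With exponent 0 the
    quotient would be 0 by the convention for division by zero. *)
Lemma bias_correction_itv (R : realFieldType) (a : R) n :
  0 <= a < 1 -> 1 - a <= (1 - a) / (1 - a ^+ n.+1) <= 1.
Proof.
move=> /andP[a0 a1].
have an : a ^+ n.+1 < 1 by rewrite exprn_ilt1.
have ana : a ^+ n.+1 <= a by rewrite exprS ler_piMr // exprn_ile1 // ltW.
have an0 : 0 <= a ^+ n.+1 by rewrite exprn_ge0.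
have p0 : 0 < 1 - a ^+ n.+1 by rewrite subr_gt0.
rewrite ler_pdivlMr // ler_pdivrMr // mul1r lerD2l lerN2 ana andbT.
by rewrite ler_piMr ?gerBl // subr_ge0 ltW.
Qed.

Lemma adam_gain_itv (R : rcfType) (alpha beta eps : R) (g : nat -> R) n :
    0 <= alpha < 1 -> 0 < eps ->
  0 <= adam_gain alpha beta eps g n.+1 <= eps^-1.
Proof.
move=> al e0; have /andP[] := bias_correction_itv n al; rewrite /adam_gain.
set p := _ / _ => pl pu; have p0 : 0 <= p.
  by rewrite (le_trans _ pl) // subr_ge0; case/andP: al => _ /ltW.
set s := Num.sqrt _; have s0 : 0 <= s by rewrite sqrtr_ge0.
have es0 : 0 < eps + s by lra.
rewrite (divr_ge0 p0 (ltW es0)) /= ler_pdivrMr // (le_trans pu) //.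
by rewrite ler_pdivlMl // mulr1 lerDl.
Qed.

(** By [ema_sqr_le] the squared momentum is at most [K * v], and [v <= q * v / (1 - beta)] because
    the bias correction [q] is at least [1 - beta]. Adding [eps] only enlarges the denominator. *)
Lemma adam_bounded (R : rcfType) (alpha beta eps : R) (g : nat -> R) n :
    0 <= alpha < 1 -> alpha ^+ 2 < beta < 1 -> 0 < eps ->
  `|adam_gain alpha beta eps g n.+1 * ema alpha g n.+1|
    <= Num.sqrt (beta / (beta - alpha ^+ 2) / (1 - beta)).
Proof.
move=> al /andP[ab be1] e0.
have be0 : 0 <= beta by rewrite (le_trans (sqr_ge0 alpha)) // ltW.
have d0 : 0 < beta - alpha ^+ 2 by rewrite subr_gt0.
have be1' : 0 < 1 - beta by rewrite subr_gt0.
have /andP[pl pu] := bias_correction_itv n al.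
have /andP[ql _] : 1 - beta <= (1 - beta) / (1 - beta ^+ n.+1) <= 1.
  by apply: bias_correction_itv; rewrite be0.
have := ema_sqr_le g n.+1 ab; rewrite /adam_gain.
set v := ema beta _ _; set m := ema _ _ _; set K := beta / _ => mv.
move: pl pu ql; set p := _ / (1 - alpha ^+ _); set q := _ / _ => pl pu ql.
have v0 : 0 <= v.
  by apply: sumr_ge0 => k _; rewrite mulr_ge0 // exprn_ge0.
have p0 : 0 <= p.
  by rewrite (le_trans _ pl) // subr_ge0; case/andP: al => _ /ltW.
have K0 : 0 <= K by rewrite divr_ge0 // ltW.
have s0 : 0 <= Num.sqrt (q * v) by rewrite sqrtr_ge0.
have es0 : 0 < eps + Num.sqrt (q * v) by lra.
have m_le : `|m| <= Num.sqrt (K / (1 - beta)) * (eps + Num.sqrt (q * v)).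
  apply: (@le_trans _ _ (Num.sqrt (K / (1 - beta)) * Num.sqrt (q * v))).
    rewrite -sqrtrM; last exact: divr_ge0 K0 (ltW be1').
    rewrite -sqrtr_sqr ler_wsqrtr //.
    apply: (le_trans mv); rewrite -mulrA ler_wpM2l // ler_pdivlMl //.
    exact: ler_wpM2r.
  by rewrite ler_wpM2l ?sqrtr_ge0 // lerDr ltW.
rewrite normrM normrM ger0_norm // normfV (gtr0_norm es0) mulrAC ler_pdivrMr //.
by rewrite (le_trans _ m_le) // ler_piMl.
Qed.

(** * Gradient of the loss *)

Lemma gradient_diag_loss (R : realType) d (lambda x a : 'rV[R]_d) i :
  gradient (fun theta => enorm (diag_act lambda (theta - x)) ^+ 2) a 0 i
    = 2 * lambda 0 i ^+ 2 * (a 0 i - x 0 i).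
Proof.
rewrite /gradient mxE /derive.
set c := 2 * _ * _.
apply: cvg_lim => //.
have F (t : 'rV[R]_d) : enorm (diag_act lambda (t - x)) ^+ 2
    = \sum_(j < d) (lambda 0 j * (t 0 j - x 0 j)) ^+ 2.
  rewrite /enorm sqr_sqrtr; last by apply: sumr_ge0 => j _; rewrite sqr_ge0.
  by apply: eq_bigr => j _; rewrite /diag_act !mxE.
(* Only the [i]-th square changes along the [i]-th axis, so the difference quotient is exactly
   affine in [h]. *)
have E : {near (0 : R)^', (fun h : R => c + h * lambda 0 i ^+ 2) =1
  (fun h : R => h^-1 *: ((fun theta => enorm (diag_act lambda (theta - x)) ^+ 2)
     (h *: delta_mx 0 i + a) - enorm (diag_act lambda (a - x)) ^+ 2))}.
  near=> h.
  have h0 : h != 0 by near: h; exact: nbhs_dnbhs_neq.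
  rewrite !F (bigD1 i) //= [in X in _ = _ *: (_ - X)](bigD1 i) //=.
  rewrite !mxE !eqxx (eq_bigr (fun j => (lambda 0 j * (a 0 j - x 0 j)) ^+ 2)).
    by rewrite /c /GRing.scale /=; field.
  by move=> j ji; rewrite !mxE eqxx (negbTE ji) mulr0 add0r.
apply: cvg_trans (near_eq_cvg E) _.
have -> : nbhs c = nbhs (c + 0 * lambda 0 i ^+ 2) by rewrite mul0r addr0.
apply: cvgD; first exact: cvg_cst.
apply: cvgMl => //; exact: (cvg_within).
Unshelve. all: by end_near. Qed.

(** * Norm and averaging estimates *)

Lemma enorm_ge0 (R : realType) d (x : 'rV[R]_d) : 0 <= enorm x.
Proof. exact: sqrtr_ge0. Qed.

Lemma normr_le_enorm (R : realType) d (x : 'rV[R]_d) i : `|x 0 i| <= enorm x.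
Proof.
rewrite -sqrtr_sqr ler_wsqrtr // (bigD1 i) //= lerDl.
by apply: sumr_ge0 => j _; exact: sqr_ge0.
Qed.

Lemma enorm_le_sum (R : realType) d (x : 'rV[R]_d) :
  enorm x <= \sum_(i < d) `|x 0 i|.
Proof.
have s0 : 0 <= \sum_(i < d) `|x 0 i| by apply: sumr_ge0.
rewrite -[leRHS]ger0_norm // -sqrtr_sqr ler_wsqrtr // expr2 mulr_suml.
apply: ler_sum => i _; rewrite -real_normK ?num_real // expr2 ler_wpM2l //.
by rewrite (bigD1 i) //= lerDl sumr_ge0.
Qed.

Lemma mean_itv (R : realFieldType) (F : nat -> R) N (lo hi : R) :
    (0 < N)%N -> (forall j, (0 < j)%N -> lo <= F j <= hi) ->
  lo <= N%:R^-1 * \sum_(1 <= j < N.+1) F j <= hi.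
Proof.
move=> N0 FP; have N0' : (0 : R) < N%:R by rewrite ltr0n.
have cst (x : R) : \sum_(1 <= j < N.+1) x = N%:R * x.
  by rewrite big_const_nat iter_addr_0 subn1 mulr_natl.
rewrite ler_pdivlMl // ler_pdivrMl // -!cst !big_nat.
by apply/andP; split; apply: ler_sum => j /andP[/FP /andP[]].
Qed.

(** * Reduction of the theorem to single coordinates *)

Theorem theorem1p3 (R : realType) (d : nat) (hd : (0 < d)%N)
  (alpha beta eps : R)
  (halpha : 0 <= alpha < 1) (hbeta : alpha ^+ 2 < beta < 1) (heps : 0 < eps)
  (gamma : nat -> R)
  (gamma_ge0 : forall n, (0 < n)%N -> 0 <= gamma n)
  (gamma_bounded : [bounded gamma n | n in [set n | (0 < n)%N]])
  (J : nat -> nat) (J_gt0 : forall n, (0 < n)%N -> (0 < J n)%N)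
  (lambda : 'rV[R]_d) (b : R) (hb : 0 <= b)
  (l : 'rV[R]_d -> 'rV[R]_d -> R)
  (hl : forall theta x, l theta x = enorm (diag_act lambda (theta - x)) ^+ 2)
  (disp : measure_display) (Omega : measurableType disp)
  (P : probability Omega R)
  (X : nat -> nat -> {RV P >-> borel_rV R d})
  (X_range : forall n j, (0 < n)%N -> (0 < j)%N ->
    forall w i, (X n j w : 'rV[R]_d) 0 i \in `[- b, b])
  (G Theta : nat -> Omega -> 'rV[R]_d)
  (hG : forall n, (0 < n)%N -> forall w,
    G n w = (J n)%:R^-1 *:
      \sum_(1 <= j < (J n).+1)
        gradient (fun theta => l theta (X n j w)) (Theta n.-1 w))
  (hTheta : forall n, (0 < n)%N -> forall w,
    Theta n w = Theta n.-1 w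
      - gamma n *: adam alpha beta eps [tuple G k.+1 w | k < n]) :
  exists c : R, forall w : Omega,
    (ereal_sup (range (fun n : nat => (enorm (Theta n w))%:E))
       <= (c * enorm (Theta 0%N w) + c)%:E)%E.

Proof.
have [Gam [Gam0 GamP]] : exists Gam : R,
    0 <= Gam /\ forall n, (0 < n)%N -> gamma n <= Gam.
  have [M [Mr MP]] := gamma_bounded.
  (* Boundedness gives a bound by every number above [M]; [|M| + 1] is one, and is nonnegative. *)
  exists (`|M| + 1); split; first by rewrite addr_ge0.
  move=> n n0; apply: le_trans (ler_norm _) _.
  by apply: MP => //; rewrite (le_lt_trans (ler_norm M)) // ltrDl.
have [al0 al1] := andP halpha.
(* [K] bounds the Adam quotient, [D] one increment; [C i] is the constant of [momentum_bounded] for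
   [kappa = 2 * lambda 0 i ^+ 2] and [a = Gam / eps]. *)
pose K := Num.sqrt (beta / (beta - alpha ^+ 2) / (1 - beta)).
pose D := Gam * K.
pose C i := b + D + Gam / eps * alpha / (1 - alpha)
  * (2 * lambda 0 i ^+ 2 * D / (1 - alpha) ^+ 2).
have bound n i w : `|Theta n w 0 i| <= `|Theta 0%N w 0 i| + C i.
  pose g k := G k w 0 i.
  have step k : Theta k.+1 w 0 i = Theta k w 0 i
      - gamma k.+1 * (adam_gain alpha beta eps g k.+1 * ema alpha g k.+1).
    by rewrite hTheta //= !mxE -(adamE _ _ _ (fun k => G k w)) mxE.
  apply: (@momentum_bounded _ alpha (2 * lambda 0 i ^+ 2) (Gam / eps) D b
    (fun k => Theta k w 0 i) (ema alpha g) g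
    (fun k => gamma k * adam_gain alpha beta eps g k)) => //.
  - by rewrite mulr_ge0 ?sqr_ge0.
  - by rewrite divr_ge0 // ltW.
  - exact: ema0.
  - exact: emaS.
  - by move=> k; rewrite step mulrA.
  - move=> k; have /andP[g0 g1] := adam_gain_itv beta g k halpha heps.
    by rewrite mulr_ge0 ?gamma_ge0 //= ler_pM ?gamma_ge0 ?GamP.
  - move=> k; rewrite step addrAC subrr add0r normrN normrM.
    by rewrite ler_pM ?adam_bounded // ger0_norm ?gamma_ge0 ?GamP.
  (* Each sample gradient is [kappa] times [theta - x] with [x] in [[- b, b]], and averaging over
     the batch preserves the resulting bounds. *)
  - move=> k; rewrite /g hG //= mxE summxE; apply: mean_itv; first exact: J_gt0.
    move=> j j0; have := X_range k.+1 j isT j0 w i; rewrite in_itv /=.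
    have -> : (fun theta => l theta (X k.+1 j w))
        = (fun theta => enorm (diag_act lambda (theta - X k.+1 j w)) ^+ 2).
      by apply/funext => theta; rewrite hl.
    rewrite gradient_diag_loss => /andP[x0 x1].
    have k0 : 0 <= 2 * lambda 0 i ^+ 2 by rewrite mulr_ge0 ?sqr_ge0.
    by apply/andP; split; apply: ler_wpM2l => //; lra.
(* Summing the coordinate bounds gives the factor [d] on the initial norm and the constant
   [\sum_(i < d) C i]; their sum dominates both, since both are nonnegative. *)
exists (d%:R + \sum_(i < d) C i) => w.
apply: ge_ereal_sup => _ [n _ <-]; rewrite lee_fin.
have D0 : 0 <= D by rewrite mulr_ge0 // sqrtr_ge0.
have C0 i : 0 <= C i.
  have h1 : 0 <= 1 - alpha by rewrite subr_ge0 ltW.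
  have h2 : 0 <= (1 - alpha) ^+ 2 by exact: sqr_ge0.
  apply: addr_ge0; first exact: addr_ge0.
  apply: mulr_ge0; apply: divr_ge0 => //; apply: mulr_ge0 => //.
    by rewrite divr_ge0 // ltW.
  by rewrite mulr_ge0 ?sqr_ge0.
have sC0 : 0 <= \sum_(i < d) C i by apply: sumr_ge0.
have d0 : (0 : R) <= d%:R by rewrite ler0n.
apply: le_trans (enorm_le_sum _) _.
apply: (@le_trans _ _ (\sum_(i < d) (enorm (Theta 0%N w) + C i))).
  apply: ler_sum => i _; apply: le_trans (bound n i w) _.
  by rewrite lerD2r normr_le_enorm.
rewrite big_split /= sumr_const card_ord -mulr_natl.
by have := mulr_ge0 sC0 (enorm_ge0 (Theta 0%N w)); lra.
Qed.
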